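(* Let $\mathcal V$ be the complexification of a real vector space $\mathcal V_{\mathbb R}$ (for instance $\mathcal V=\mathbb C^{n}$ or $\mathbb C^{n\times n}$), whose elements lying in $\mathcal V_{\mathbb R}$ are called real. Let $H$ and $V$ be commuting real linear operators on $\mathcal V$, i.e. $HV=VH$ and both map real elements to real elements, and let $A=H+V$, $b\in\mathcal V$. Consider the ADI method for $Ax=b$ with parameters $\alpha_j,\beta_j\in\mathbb C$ ($j\in\mathbb N$), its iterates $x^j$ and its residuals $r^j:=Ax^j-b$. Suppose that for some fixed $k\in\mathbb N$ the iterate $x^k$ and the residual $r^k$ are real, and that the next ADI parameters fulfill $$\alpha_k\alpha_{k+1},\quad \alpha_k+\alpha_{k+1},\quad \beta_k\beta_{k+1},\quad \beta_k+\beta_{k+1}\in\mathbb R .$$ Then, two ADI steps later, the iterate $x^{k+2}$ and the residual $r^{k+2}$ are real again.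
   Context: The ADI (alternating-direction implicit) method for $Ax=b$ with $A=H+V$ and parameters $\alpha_j,\beta_j\in\mathbb C$ is the iteration $$(H+\alpha_jI)\,x^{j+1/2}=b-(V-\alpha_jI)\,x^j,\qquad (V+\beta_jI)\,x^{j+1}=b-(H-\beta_jI)\,x^{j+1/2},\qquad j\in\mathbb N,$$ where it is assumed that $\alpha_j+\beta_j\neq0$ and that $H+\alpha_jI$ and $V+\beta_jI$ are invertible for all $j$. For commuting $H,V$ it can be written as the splitting scheme $M_jx^{j+1}=N_jx^j+b$ with $M_j=(\alpha_j+\beta_j)^{-1}(H+\alpha_jI)(V+\beta_jI)$ and $N_j=(\alpha_j+\beta_j)^{-1}(H-\beta_jI)(V-\alpha_jI)$, so that $A=M_j-N_j$. *)

(* Defs.v *)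
From HB Require Import structures.
From mathcomp Require Import all_boot all_order all_algebra.
From mathcomp Require Import reals.
From mathcomp Require Import complex.

Set Implicit Arguments.
Unset Strict Implicit.
Unset Printing Implicit Defensive.

Import Order.TTheory GRing.Theory Num.Theory.
Local Open Scope ring_scope.
Local Open Scope complex_scope.

(* The pair (u, v) stands for u + i v. This is an alias and not just U * U,
   because U * U already has its componentwise scaling by R. *)
Definition complexification (R : realType) (U : lmodType R) : Type :=
  (U * U)%type.

Section Complexification.
Variables (R : realType) (U : lmodType R).

HB.instance Definition _ :=
  GRing.Zmodule.copy (complexification U) (U * U)%type.

Definition cscale (z : R[i]) (w : complexification U) : complexification U :=
  let: a +i* b := z in (a *: w.1 - b *: w.2, a *: w.2 + b *: w.1).

Fact cscaleA (y z : R[i]) w : cscale y (cscale z w) = cscale (y * z) w.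
Proof.
case: y => a b; case: z => c d; case: w => u v; congr (_, _) => /=.
  rewrite scalerBr scalerDr !scalerA scalerBl scalerDl !opprD [RHS]addrACA.
  by congr (_ + _); exact: addrC.
rewrite scalerBr scalerDr !scalerA scalerBl scalerDl [RHS]addrACA.
by congr (_ + _); exact: addrC.
Qed.

Fact cscale1 : left_id 1 cscale.
Proof.
by case=> u v; congr (_, _) => /=; rewrite scale1r scale0r ?subr0 ?addr0.
Qed.

Fact cscaleDr : right_distributive cscale +%R.
Proof.
case=> a b [u v] [u' v']; congr (_, _) => /=; rewrite !scalerDr ?opprD.
  exact: addrACA.
exact: addrACA.
Qed.

Fact cscaleDl w : {morph cscale^~ w : y z / y + z}.
Proof.
case: w => u v [a b] [c d]; congr (_, _) => /=; rewrite !scalerDl ?opprD.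
  exact: addrACA.
exact: addrACA.
Qed.

HB.instance Definition _ := GRing.Zmodule_isLmodule.Build R[i]
  (complexification U) cscaleA cscale1 cscaleDr cscaleDl.

Definition of_real (u : U) : complexification U := (u, 0).

Lemma complexificationE (w : complexification U) :
  w = of_real w.1 + 'i *: of_real w.2.
Proof.
case: w => u v; congr (_, _) => /=.
  by rewrite scaler0 subr0 scale0r addr0.
by rewrite scaler0 scale1r !add0r.
Qed.

Definition is_real (w : complexification U) : Prop := exists u, w = of_real u.

Definition real_operator (T : complexification U -> complexification U) : Prop :=
  forall w, is_real w -> is_real (T w).

End Complexification.

(* xhalf j is the half-step iterate x^{j+1/2}. *)
Definition adi_iteration (C : nzRingType) (E : lmodType C) (H V : E -> E) (b : E)
    (alpha beta : nat -> C) (x xhalf : nat -> E) : Prop :=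
  forall j : nat,
    (H \+ alpha j \*: idfun) (xhalf j) = b - (V \- alpha j \*: idfun) (x j) /\
    (V \+ beta j \*: idfun) (x j.+1) = b - (H \- beta j \*: idfun) (xhalf j).

Definition residual (E : zmodType) (A : E -> E) (b : E) (x : nat -> E) (j : nat) : E :=
  A (x j) - b.

(* Main.v *)
(** The ADI step reads (H + a)(V + c) (x' - x) = - (a + c) r, and it maps the
residual to (H + a)(V + c) r' = (H - c)(V - a) r.  Two steps with parameters
(a, c) and (a', c') therefore give
  (H + a)(H + a')(V + c)(V + c') (x'' - x)
    = - [(a + c)(H + a')(V + c') + (a' + c')(H - c)(V - a)] r.
The quadratics on the left have the real coefficients a + a', a a', c + c',
c c'; expanding the bracket, all its coefficients are polynomials in these four
numbers.  An injective real operator reflects real elements, so x'' - x is real. *)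
Require Import Defs.
From mathcomp Require Import all_boot all_order all_algebra.
From mathcomp Require Import reals.
From mathcomp Require Import complex.
From mathcomp Require Import ring.

Import Order.TTheory GRing.Theory Num.Theory.
Local Open Scope ring_scope.
Local Open Scope complex_scope.

(** * Operator identities for one and two ADI steps *)

Section TwoSteps.
Set Implicit Arguments.
Unset Strict Implicit.
Variables (C : comNzRingType) (E : lmodType C) (H V : {linear E -> E}).
Hypothesis HV : forall u, H (V u) = V (H u).
Implicit Types (a c z : C) (u : E).

(** Normal form for the operators spanned by [HV], [H], [V] and the identity. Once both sides of an
    identity are in this form, it reduces to four scalar identities, which [ring] settles. *)
Definition bilin_comb c11 c10 c01 c00 u : E :=
  c11 *: H (V u) + c10 *: H u + c01 *: V u + c00 *: u.

Lemma bilin_combD c11 c10 c01 c00 d11 d10 d01 d00 u :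
  bilin_comb c11 c10 c01 c00 u + bilin_comb d11 d10 d01 d00 u =
  bilin_comb (c11 + d11) (c10 + d10) (c01 + d01) (c00 + d00) u.
Proof.
by rewrite /bilin_comb !scalerDl addrACA; congr (_ + _); rewrite addrACA;
  congr (_ + _); rewrite addrACA.
Qed.

Lemma bilin_combZ z c11 c10 c01 c00 u :
  z *: bilin_comb c11 c10 c01 c00 u =
  bilin_comb (z * c11) (z * c10) (z * c01) (z * c00) u.
Proof. by rewrite /bilin_comb !scalerDr !scalerA. Qed.

Lemma bilin_combN c11 c10 c01 c00 u :
  - bilin_comb c11 c10 c01 c00 u = bilin_comb (- c11) (- c10) (- c01) (- c00) u.
Proof. by rewrite -scaleN1r bilin_combZ !mulN1r. Qed.

Lemma bilin_comb_sum u : (H \+ V) u = bilin_comb 0 1 1 0 u.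
Proof. by rewrite /bilin_comb !scale0r !scale1r add0r addr0. Qed.

Lemma bilin_comb_shift a c u :
  (H \+ a \*: idfun) ((V \+ c \*: idfun) u) = bilin_comb 1 c a (a * c) u.
Proof.
by rewrite /bilin_comb /= linearD linearZ scale1r scalerDr scalerA !addrA.
Qed.

Lemma bilin_comb_subshift a c u :
  (H \- c \*: idfun) ((V \- a \*: idfun) u) =
  bilin_comb 1 (- a) (- c) (a * c) u.
Proof.
rewrite /bilin_comb /= linearB linearZ scale1r scalerBr scalerA !scaleNr.
by rewrite opprB [c * a]mulrC [_ - c *: V u]addrC !addrA.
Qed.

Lemma shiftD (T : {linear E -> E}) a :
  {morph (T \+ a \*: idfun) : u v / u + v}.
Proof. exact: raddfD. Qed.

Lemma shiftB (T : {linear E -> E}) a :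
  {morph (T \+ a \*: idfun) : u v / u - v}.
Proof. exact: raddfB. Qed.

Lemma shiftN (T : {linear E -> E}) a : {morph (T \+ a \*: idfun) : u / - u}.
Proof. exact: raddfN. Qed.

Lemma shiftZ (T : {linear E -> E}) a z :
  {morph (T \+ a \*: idfun) : u / z *: u}.
Proof. exact: linearZ. Qed.

Lemma shift_comm (T S : {linear E -> E}) a u :
  T (S u) = S (T u) -> (T \+ a \*: idfun) (S u) = S ((T \+ a \*: idfun) u).
Proof. by move=> TS; rewrite /= TS linearD linearZ_LR. Qed.

Lemma bishift_comm a c u :
  (H \+ a \*: idfun) ((V \+ c \*: idfun) u) =
  (V \+ c \*: idfun) ((H \+ a \*: idfun) u).
Proof.
apply: (@shift_comm H (V \+ c \*: idfun)).
by rewrite [LHS]/= linearD linearZ_LR (HV u).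
Qed.

Lemma shift_shift_comm (T : {linear E -> E}) a c u :
  (T \+ a \*: idfun) ((T \+ c \*: idfun) u) =
  (T \+ c \*: idfun) ((T \+ a \*: idfun) u).
Proof.
apply: (@shift_comm T (T \+ c \*: idfun)).
by rewrite [LHS]/= linearD linearZ_LR.
Qed.

Lemma shift_mul (T : {linear E -> E}) a c u :
  (T \+ a \*: idfun) ((T \+ c \*: idfun) u) =
  T (T u) + (a + c) *: T u + (a * c) *: u.
Proof.
by rewrite /= linearD linearZ_LR scalerDr scalerA scalerDl [a *: _ + c *: _]addrC
  !addrA.
Qed.

Lemma residual_increment (A : {linear E -> E}) b x x' :
  A x' - b = (A x - b) + A (x' - x).
Proof. by rewrite linearB [RHS]addrC addrA subrK. Qed.

(** Applying [H + a] to the second half step and commuting it past [H - c] eliminates [h]: (H + a)(V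
    + c) x' = (a + c) b + (H - c)(V - a) x. The claim then follows from (H + a)(V + c) - (H - c)(V -
    a) = (a + c)(H + V). *)
Lemma adi_step_increment a c b x h x' :
    (H \+ a \*: idfun) h = b - (V \- a \*: idfun) x ->
    (V \+ c \*: idfun) x' = b - (H \- c \*: idfun) h ->
  (H \+ a \*: idfun) ((V \+ c \*: idfun) (x' - x)) =
  - ((a + c) *: ((H \+ V) x - b)).
Proof.
move=> eq_h eq_x'.
have swap : (H \+ a \*: idfun) ((H \- c \*: idfun) h) =
    (H \- c \*: idfun) ((H \+ a \*: idfun) h).
  apply: (@shift_comm H (H \- c \*: idfun)).
  by rewrite [LHS]/= linearB linearZ_LR.
have subshiftB u v : (H \- c \*: idfun) (u - v) =
    (H \- c \*: idfun) u - (H \- c \*: idfun) v by exact: raddfB.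
have eq_b : (H \+ a \*: idfun) b - (H \- c \*: idfun) b = (a + c) *: b.
  by rewrite /= scalerDl opprB addrC addrA subrK addrC.
rewrite shiftB eq_x' 2!shiftB swap eq_h subshiftB.
rewrite bilin_comb_subshift bilin_comb_shift bilin_comb_sum.
rewrite opprB addrCA eq_b scalerBr opprB [_ + (a + c) *: b]addrC -addrA.
congr (_ + _).
rewrite bilin_combZ !bilin_combN bilin_combD; congr bilin_comb; ring.
Qed.

(** Both shifts commute with [H + V], so applying them to r' = r + (H + V)(x' - x) gives
    [(H + a)(V + c) - (a + c)(H + V)] r, which is the right-hand side. *)
Lemma adi_step_residual a c b x x' :
    (H \+ a \*: idfun) ((V \+ c \*: idfun) (x' - x)) =
    - ((a + c) *: ((H \+ V) x - b)) ->
  (H \+ a \*: idfun) ((V \+ c \*: idfun) ((H \+ V) x' - b)) =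
  (H \- c \*: idfun) ((V \- a \*: idfun) ((H \+ V) x - b)).
Proof.
move=> eq_d; set r := (H \+ V) x - b.
have -> : (H \+ V) x' - b = r + (H \+ V) (x' - x).
  exact: (residual_increment (H \+ V)).
have sumZ z u : (H \+ V) (z *: u) = z *: (H \+ V) u by exact: linearZ.
have commV u : (V \+ c \*: idfun) ((H \+ V) u) =
    (H \+ V) ((V \+ c \*: idfun) u).
  by apply: (@shift_comm V (H \+ V)); rewrite /= linearD (HV u).
have commH u : (H \+ a \*: idfun) ((H \+ V) u) =
    (H \+ V) ((H \+ a \*: idfun) u).
  by apply: (@shift_comm H (H \+ V)); rewrite /= linearD (HV u).
rewrite (shiftD V) (shiftD H) commV commH eq_d -/r -scaleNr sumZ.
rewrite bilin_comb_shift bilin_comb_sum bilin_comb_subshift.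
rewrite bilin_combZ bilin_combD; congr bilin_comb; ring.
Qed.

Lemma adi_two_steps a c a' c' b x h x' h' x'' (r := (H \+ V) x - b) :
    (H \+ a \*: idfun) h = b - (V \- a \*: idfun) x ->
    (V \+ c \*: idfun) x' = b - (H \- c \*: idfun) h ->
    (H \+ a' \*: idfun) h' = b - (V \- a' \*: idfun) x' ->
    (V \+ c' \*: idfun) x'' = b - (H \- c' \*: idfun) h' ->
  (H \+ a \*: idfun) ((H \+ a' \*: idfun)
    ((V \+ c \*: idfun) ((V \+ c' \*: idfun) (x'' - x)))) =
  - bilin_comb (a + a' + (c + c')) (c * c' - a * a') (a * a' - c * c')
      (a * a' * (c + c') + c * c' * (a + a')) r.
Proof.
move=> eq_h eq_x' eq_h' eq_x''.
have d1 := adi_step_increment eq_h eq_x'.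
have d2 := adi_step_increment eq_h' eq_x''.
have r1 := adi_step_residual d1.
have -> : x'' - x = (x' - x) + (x'' - x') by rewrite [RHS]addrC addrA subrK.
rewrite (shiftD V c') (shiftD V c) (shiftD H a') (shiftD H a).
(* For the first increment the shifts by [a] and [c] must stand innermost, so that [d1] applies; for
   the second increment those by [a'] and [c'] must, so that [d2] applies. *)
have -> : (H \+ a \*: idfun) ((H \+ a' \*: idfun)
    ((V \+ c \*: idfun) ((V \+ c' \*: idfun) (x' - x)))) =
    (H \+ a' \*: idfun) ((V \+ c' \*: idfun)
    ((H \+ a \*: idfun) ((V \+ c \*: idfun) (x' - x)))).
  by rewrite (shift_shift_comm V) -!bishift_comm (shift_shift_comm H a).
rewrite (bishift_comm a' c) d2 d1 -/r 4!shiftN 4!shiftZ r1 -/r.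
rewrite bilin_comb_subshift bilin_comb_shift.
(* In the coefficients of [H] and [V] the mixed products a c' and a' c cancel; only sums and
   products of the pairs (a, a') and (c, c') survive. *)
rewrite !bilin_combZ -opprD bilin_combD; congr (- bilin_comb _ _ _ _ _); ring.
Qed.

End TwoSteps.

(** * Real elements and real operators *)

Section RealElements.
Set Implicit Arguments.
Unset Strict Implicit.
Variables (R : realType) (U : lmodType R).
Implicit Types (w : complexification U) (T : {linear complexification U -> complexification U}).

Lemma is_realD w w' : is_real w -> is_real w' -> is_real (w + w').
Proof.
move=> [u ->] [v ->]; exists (u + v).
by apply: injective_projections; rewrite //= addr0.
Qed.

Lemma is_realZ (z : R[i]) w : z \is Num.real -> is_real w -> is_real (z *: w).
Proof.
move=> /complex_realP[t ->] [u ->]; exists (t *: u).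
by apply: injective_projections; rewrite /= ?scaler0 ?scale0r ?subr0 ?addr0.
Qed.

Lemma is_realN w : is_real w -> is_real (- w).
Proof. by move=> rw; rewrite -scaleN1r; apply: is_realZ => //; rewrite rpredN rpred1. Qed.

Lemma is_real_bilin_comb (H V : {linear complexification U -> complexification U})
    (c11 c10 c01 c00 : R[i]) w :
  real_operator H -> real_operator V ->
  c11 \is Num.real -> c10 \is Num.real -> c01 \is Num.real -> c00 \is Num.real ->
  is_real w -> is_real (bilin_comb H V c11 c10 c01 c00 w).
Proof.
move=> rH rV *.
by do ![apply: is_realD]; apply: is_realZ => //; do ?[apply: rH | apply: rV].
Qed.

(** For w = u + i v, both T u and T v are real, so T v is the imaginary part of T w. It vanishes
    when T w is real, and injectivity gives v = 0. *)
Lemma real_operator_reflect T w :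
  real_operator T -> injective T -> is_real (T w) -> is_real w.
Proof.
move=> rT injT; rewrite [w in T w]complexificationE linearD linearZ_LR.
have [u ->] : is_real (T (of_real w.1)) by apply: rT; exists w.1.
have [v Tv] : is_real (T (of_real w.2)) by apply: rT; exists w.2.
rewrite Tv => -[t /(congr1 snd)]; rewrite /= scale0r scale1r !add0r => v0.
have /(congr1 fst) /= w20 : of_real w.2 = 0.
  by apply: injT; rewrite Tv v0 raddf0.
by exists w.1; rewrite /of_real -w20; case: (w).
Qed.

(** The two shifts may be non-real individually, but their product has only the coefficients 1, a +
    c and a c. *)
Lemma real_shift_mul T (a c : R[i]) :
  real_operator T -> a * c \is Num.real -> a + c \is Num.real ->
  real_operator ((T \+ a \*: idfun) \o (T \+ c \*: idfun)).
Proof.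
move=> rT acM acD w rw; rewrite [_ w]shift_mul.
have rTw := rT _ rw.
by do !apply: is_realD; [apply: rT | apply: is_realZ..].
Qed.

End RealElements.

Theorem theorem3p2 (R : realType) (U : lmodType R)
    (H V : {linear complexification U -> complexification U})
    (b : complexification U)
    (alpha beta : nat -> R[i])
    (x xhalf : nat -> complexification U)
    (HV : H \o V =1 V \o H)
    (Hreal : real_operator H)
    (Vreal : real_operator V)
    (ab_neq0 : forall j : nat, alpha j + beta j != 0)
    (Hinv : forall j : nat, bijective (H \+ alpha j \*: idfun))
    (Vinv : forall j : nat, bijective (V \+ beta j \*: idfun))
    (ADI : adi_iteration H V b alpha beta x xhalf)
    (k : nat)
    (xk_real : is_real (x k))
    (rk_real : is_real (residual (H \+ V) b x k))
    (alphaM : alpha k * alpha k.+1 \is Num.real)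
    (alphaD : alpha k + alpha k.+1 \is Num.real)
    (betaM : beta k * beta k.+1 \is Num.real)
    (betaD : beta k + beta k.+1 \is Num.real) :
  is_real (x k.+2) /\ is_real (residual (H \+ V) b x k.+2).
Proof.
have [eq_h eq_x'] := ADI k; have [eq_h' eq_x''] := ADI k.+1.
have injH j := bij_inj (Hinv j); have injV j := bij_inj (Vinv j).
have real_d : is_real (x k.+2 - x k).
  (* The quadratics in [V] and then in [H] are applied to the increment; each is real, and injective
     as a composite of invertible shifts. This produces the left-hand side of [adi_two_steps]. *)
  apply: (@real_operator_reflect _ _
    ((V \+ beta k \*: idfun) \o (V \+ beta k.+1 \*: idfun))).
  - exact: real_shift_mul.
  - apply: inj_comp; exact: injV.
  apply: (@real_operator_reflect _ _
    ((H \+ alpha k \*: idfun) \o (H \+ alpha k.+1 \*: idfun))).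
  - exact: real_shift_mul.
  - apply: inj_comp; exact: injH.
  rewrite [X in is_real X](adi_two_steps HV eq_h eq_x' eq_h' eq_x'').
  apply/is_realN/is_real_bilin_comb => //;
    by do ![done | apply: rpredB | apply: rpredD | apply: rpredM].
(* The iterate changes by this real increment and the residual by its image under the real operator
   [H + V]. *)
have -> : x k.+2 = x k + (x k.+2 - x k) by rewrite addrC subrK.
split; first exact: is_realD.
rewrite /residual.
have -> : (H \+ V) (x k.+2) - b =
    residual (H \+ V) b x k + (H \+ V) (x k.+2 - x k).
  exact: (residual_increment (H \+ V)).
by apply: is_realD => //; apply: is_realD; [exact: Hreal | exact: Vreal].
Qed.
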